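(* Let $\lambda$ be a nonzero cardinal, $S$ an arbitrary monoid and $\theta\colon S\to H_S(1_S)$ a homomorphism. Then the semigroup $\mathscr{P}_\lambda(\theta,S)$ is $0$-simple.
   Context: A semigroup is called $0$-simple if it contains a zero and has no proper two-sided ideals other than $\{0\}$. For a nonzero cardinal $\lambda$, $\lambda^*$ is the free monoid over the alphabet $\lambda$, $\varepsilon$ is the empty word and $|a|$ is the length of a word $a$. The $\lambda$-polycyclic monoid $P_\lambda$ is the semigroup with zero $0$ and identity $1$ generated by $\{p_i\}_{i\in\lambda}\cup\{p_i^{-1}\}_{i\in\lambda}$ subject to $p_ip_i^{-1}=1$ and $p_ip_j^{-1}=0$ for $i\ne j$ (for $\lambda=1$ it is the bicyclic monoid with adjoined zero). Identifying words of $\lambda^*$ with products of the $p_i$, each nonzero element of $P_\lambda$ is uniquely of the form $a^{-1}b$ with $a,b\in\lambda^*$. For a monoid $S$ with identity $1_S$, $H_S(1_S)$ is its group of units. Given a homomorphism $\theta\colon S\to H_S(1_S)$, put $\theta^0(s)=s$ and $\theta^n=\theta\circ\cdots\circ\theta$ ($n$ times). The Bruck–Reilly $\lambda$-polycyclic extension is the set $\mathscr{P}_\lambda(\theta,S)=(S\times(P_\lambda\setminus\{0\}))\sqcup\{\boldsymbol{0}\}$ with the associative operation $*$ for which $\boldsymbol{0}$ is a zero and $$(s,a_1^{-1}a_2)*(t,b_1^{-1}b_2)=\begin{cases}(\theta^{|u|}(s)t,(ua_1)^{-1}b_2), & \text{if } b_1=ua_2 \text{ for some } u\in\lambda^*,\\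 (s\theta^{|v|}(t),a_1^{-1}vb_2), & \text{if } a_2=vb_1 \text{ for some } v\in\lambda^*,\\ \boldsymbol{0}, & \text{otherwise.}\end{cases}$$ *)

(* Defs.v *)
From HB Require Import structures.
From mathcomp Require Import all_boot classical_sets.

Set Implicit Arguments.
Unset Strict Implicit.
Unset Printing Implicit Defensive.

Import Algebra.
Local Open Scope classical_set_scope.
Local Open Scope group_scope.

Definition is_zero (T : semigroupType) (z : T) : Prop :=
  forall x : T, z * x = z /\ x * z = z.

(* Ideals are nonempty, as usual in semigroup theory. *)
Definition two_sided_ideal (T : semigroupType) (I : set T) : Prop :=
  I !=set0 /\ forall x a : T, I a -> I (x * a) /\ I (a * x).

Definition zero_simple (T : semigroupType) : Prop :=
  exists z : T, is_zero z /\
    forall I : set T, two_sided_ideal I -> I <> setT -> I = [set z].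

(* H_S(1_S), the H-class of the identity. *)
Definition group_of_units (S : monoidType) : set S :=
  [set x | exists y : S, x * y = 1 /\ y * x = 1].
Arguments group_of_units : clear implicits.

(* [strip a w] is the word u such that w = u ++ a, when a is a suffix of w. *)
Definition strip (T : Type) (a w : seq T) : seq T := take (size w - size a) w.

(* The cardinal lambda is represented by a type L with that many elements; the
   choiceType structures on L and on monoids are no restriction classically. *)

(* The pair (a, b) stands for the nonzero element a^-1 b of P_L, where the
   inverse of the word a = i1 ... ik is p_ik^-1 ... p_i1^-1; by uniqueness of
   this normal form, the pairs enumerate P_L \ {0}. *)
Definition polycyclic_nz (L : choiceType) : Type := (seq L * seq L)%type.
HB.instance Definition _ (L : choiceType) := Choice.on (polycyclic_nz L).

(* [None] is the zero; see [polycyclic_presented] for the agreement with the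
   presentation by generators and relations. *)
Definition polycyclic (L : choiceType) : Type := option (polycyclic_nz L).
HB.instance Definition _ (L : choiceType) := Choice.on (polycyclic L).

Definition polycyclic_mul (L : choiceType) (x y : polycyclic L) :
    polycyclic L :=
  match x, y with
  | Some (a1, a2), Some (b1, b2) =>
      if suffix a2 b1 then Some (strip a2 b1 ++ a1, b2)
      else if suffix b1 a2 then Some (a1, strip b1 a2 ++ b2)
      else None
  | _, _ => None
  end.

(* The first two cases overlap only when b1 = a2, where they agree. *)
Definition bruck_reilly_mul (L : choiceType) (S : monoidType) (theta : S -> S)
    (x y : option (S * polycyclic_nz L)) : option (S * polycyclic_nz L) :=
  match x, y with
  | Some (s, (a1, a2)), Some (t, (b1, b2)) =>
      if suffix a2 b1 then
        let u := strip a2 b1 in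
        Some (iter (size u) theta s * t, (u ++ a1, b2))
      else if suffix b1 a2 then
        let v := strip b1 a2 in
        Some (s * iter (size v) theta t, (a1, v ++ b2))
      else None
  | _, _ => None
  end.

(* Associativity only uses that theta is an endomorphism of S, so that the
   hypothesis that theta takes its values in the units is left to theorems. *)
Definition bruck_reilly (L : choiceType) (S : monoidType)
    (theta : {multiplicative S -> S}) : Type := option (S * polycyclic_nz L).
HB.instance Definition _ (L : choiceType) (S : monoidType)
  (theta : {multiplicative S -> S}) := Choice.on (bruck_reilly L theta).

Section Words.
Variable T : eqType.
Implicit Types a b u w : seq T.

Lemma strip_cat a u : strip a (u ++ a) = u.
Proof. by rewrite /strip size_cat addnK take_size_cat. Qed.

Variant word_cmp a b : Prop :=
  | CmpL u of b = u ++ a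
  | CmpR v of a = v ++ b
  | CmpN of ~~ suffix a b & ~~ suffix b a.

Lemma word_cmpP a b : word_cmp a b.
Proof.
case Sab: (suffix a b).
  by case/suffixP: Sab => u ub; exact: CmpL ub.
case Sba: (suffix b a); last by apply: CmpN; rewrite ?Sab ?Sba.
by case/suffixP: Sba => v va; exact: CmpR va.
Qed.

Lemma suffix_cat2r a b w : suffix (a ++ w) (b ++ w) = suffix a b.
Proof. by rewrite suffix_catl // eqxx. Qed.

Lemma suffix_total a b w : suffix a w -> suffix b w -> suffix a b || suffix b a.
Proof.
wlog le_ab : a b / size a <= size b => [IH Ha Hb|Ha Hb].
  case/orP: (leq_total (size a) (size b)) => le; first exact: IH.
  by rewrite orbC; exact: IH.
have le_bw := size_suffix Hb.
move: Ha Hb; rewrite !suffixE => /eqP Ha /eqP Hb; apply/orP; left.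
by rewrite -{2}Hb drop_drop addnC addnBA // subnK // Ha.
Qed.

End Words.

Section BruckReilly.
Variables (L : choiceType) (S : monoidType) (theta : {multiplicative S -> S}).
Implicit Types (s t : S) (a b u v : seq L).

Local Notation BR := (bruck_reilly L theta).
Local Notation elt s a b := (Some (s, (a, b)) : BR).
Local Notation "x '*br' y" := (bruck_reilly_mul theta x y) (at level 40).

Lemma iter_thetaM n : {morph iter n theta : s t / s * t}.
Proof.
by elim: n => //= n IHn s t; rewrite !iterS IHn gmulfM.
Qed.

Lemma bruck_reilly_mulL s t a1 a2 b2 u :
  elt s a1 a2 *br elt t (u ++ a2) b2
  = elt (iter (size u) theta s * t) (u ++ a1) b2.
Proof. by rewrite /= suffix_suffix strip_cat. Qed.

Lemma bruck_reilly_mulR s t a1 b1 b2 v :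
  elt s a1 (v ++ b1) *br elt t b1 b2
  = elt (s * iter (size v) theta t) a1 (v ++ b2).
Proof.
rewrite /=; case: ifP => [Sba|_]; last by rewrite suffix_suffix strip_cat.
have v0 : v = [::].
  by have := size_suffix Sba; rewrite size_cat -{2}[size b1]add0n leq_add2r;
    case: v {Sba}.
by rewrite v0 /= -[strip b1 b1]/(strip b1 ([::] ++ b1)) strip_cat.
Qed.

Lemma bruck_reilly_mulN s t a1 a2 b1 b2 :
  ~~ suffix a2 b1 -> ~~ suffix b1 a2 -> elt s a1 a2 *br elt t b1 b2 = None.
Proof. by move=> /negbTE Sab /negbTE Sba; rewrite /= Sab Sba. Qed.

Lemma bruck_reilly_mulx0 (x : BR) : x *br None = None.
Proof. by case: x => [[s [a b]]|]. Qed.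

Lemma bruck_reilly_mulA : associative (@bruck_reilly_mul L S theta).
Proof.
move=> [[s [a b]]|] [[t [c d]]|] [[r [e f]]|] //; last by rewrite !bruck_reilly_mulx0.
have [p ep|q dq|Nde Ned] := word_cmpP d e.
- rewrite ep bruck_reilly_mulL.
  have [u cu|v bv|Nbc Ncb] := word_cmpP b c.
  + rewrite cu bruck_reilly_mulL catA !bruck_reilly_mulL -catA.
    by rewrite size_cat iterD iter_thetaM mulgA.
  + rewrite bv bruck_reilly_mulR.
    have [p' pp'|v' vv'|Nvp Npv] := word_cmpP v p.
    * rewrite pp' -!catA bruck_reilly_mulL [p' ++ v ++ d]catA.
      rewrite -catA bruck_reilly_mulL.
      by rewrite size_cat iterD iter_thetaM mulgA.
    * rewrite vv' -!catA !bruck_reilly_mulR.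
      by rewrite size_cat iterD iter_thetaM mulgA.
    * by rewrite !bruck_reilly_mulN ?suffix_cat2r.
  + rewrite (bruck_reilly_mulN _ _ _ _ Nbc Ncb).
    apply: bruck_reilly_mulN; last by apply: contra Ncb => /catl_suffix.
    apply/negP => Sb.
    have := suffix_total Sb (suffix_suffix p c).
    by rewrite (negbTE Nbc) (negbTE Ncb).
- rewrite dq bruck_reilly_mulR.
  have [u cu|v bv|Nbc Ncb] := word_cmpP b c.
  + by rewrite cu !bruck_reilly_mulL bruck_reilly_mulR mulgA.
  + rewrite bv !bruck_reilly_mulR [v ++ q ++ e]catA bruck_reilly_mulR.
    by rewrite size_cat iterD iter_thetaM mulgA catA.
  + by rewrite !(bruck_reilly_mulN _ _ _ _ Nbc Ncb).
rewrite (bruck_reilly_mulN _ _ _ _ Nde Ned) bruck_reilly_mulx0.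
have [u cu|v bv|Nbc Ncb] := word_cmpP b c.
- by rewrite cu bruck_reilly_mulL bruck_reilly_mulN.
- rewrite bv bruck_reilly_mulR bruck_reilly_mulN //.
    by apply: contra Nde => /catl_suffix.
  apply/negP => Se.
  have := suffix_total Se (suffix_suffix v d).
  by rewrite (negbTE Nde) (negbTE Ned).
- by rewrite (bruck_reilly_mulN _ _ _ _ Nbc Ncb).
Qed.

HB.instance Definition _ := isSemigroup.Build BR bruck_reilly_mulA.

End BruckReilly.

Section Polycyclic.
Variable L : choiceType.
Implicit Types (a b u v : seq L) (x y : polycyclic L) (i j : L).

Local Notation elt a b := (Some (a, b) : polycyclic L).
Local Notation "x '*p' y" := (polycyclic_mul x y) (at level 40).

Lemma polycyclic_mulL a1 a2 b2 u :
  elt a1 a2 *p elt (u ++ a2) b2 = elt (u ++ a1) b2.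
Proof. by rewrite /= suffix_suffix strip_cat. Qed.

Lemma polycyclic_mulR a1 b1 b2 v :
  elt a1 (v ++ b1) *p elt b1 b2 = elt a1 (v ++ b2).
Proof.
rewrite /=; case: ifP => [Sba|_]; last by rewrite suffix_suffix strip_cat.
have v0 : v = [::].
  by have := size_suffix Sba; rewrite size_cat -{2}[size b1]add0n leq_add2r;
    case: v {Sba}.
by rewrite v0 /= -[strip b1 b1]/(strip b1 ([::] ++ b1)) strip_cat.
Qed.

Lemma polycyclic_mulN a1 a2 b1 b2 :
  ~~ suffix a2 b1 -> ~~ suffix b1 a2 -> elt a1 a2 *p elt b1 b2 = None.
Proof. by move=> /negbTE Sab /negbTE Sba; rewrite /= Sab Sba. Qed.

Lemma polycyclic_mulx0 x : x *p None = None.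
Proof. by case: x => [[a b]|]. Qed.

Lemma polycyclic_mulA : associative (@polycyclic_mul L).
Proof.
move=> [[a b]|] [[c d]|] [[e f]|] //; last by rewrite !polycyclic_mulx0.
have [p ep|q dq|Nde Ned] := word_cmpP d e.
- rewrite ep polycyclic_mulL.
  have [u cu|v bv|Nbc Ncb] := word_cmpP b c.
  + by rewrite cu polycyclic_mulL catA !polycyclic_mulL -catA.
  + rewrite bv polycyclic_mulR.
    have [p' pp'|v' vv'|Nvp Npv] := word_cmpP v p.
    * rewrite pp' -!catA polycyclic_mulL [p' ++ v ++ d]catA.
      by rewrite -catA polycyclic_mulL.
    * by rewrite vv' -!catA !polycyclic_mulR.
    * by rewrite !polycyclic_mulN ?suffix_cat2r.
  + rewrite (polycyclic_mulN _ _ Nbc Ncb).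
    apply: polycyclic_mulN; last by apply: contra Ncb => /catl_suffix.
    apply/negP => Sb.
    have := suffix_total Sb (suffix_suffix p c).
    by rewrite (negbTE Nbc) (negbTE Ncb).
- rewrite dq polycyclic_mulR.
  have [u cu|v bv|Nbc Ncb] := word_cmpP b c.
  + by rewrite cu !polycyclic_mulL polycyclic_mulR.
  + by rewrite bv !polycyclic_mulR [v ++ q ++ e]catA polycyclic_mulR catA.
  + by rewrite !(polycyclic_mulN _ _ Nbc Ncb).
rewrite (polycyclic_mulN _ _ Nde Ned) polycyclic_mulx0.
have [u cu|v bv|Nbc Ncb] := word_cmpP b c.
- by rewrite cu polycyclic_mulL polycyclic_mulN.
- rewrite bv polycyclic_mulR polycyclic_mulN //.
    by apply: contra Nde => /catl_suffix.
  apply/negP => Se.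
  have := suffix_total Se (suffix_suffix v d).
  by rewrite (negbTE Nde) (negbTE Ned).
- by rewrite (polycyclic_mulN _ _ Nbc Ncb).
Qed.

Definition polycyclic_one : polycyclic L := Some ([::], [::]).

Lemma polycyclic_mul1x : left_id polycyclic_one (@polycyclic_mul L).
Proof.
by case=> [[a b]|] //; rewrite -[a in LHS]cats0 polycyclic_mulL cats0.
Qed.

Lemma polycyclic_mulx1 : right_id polycyclic_one (@polycyclic_mul L).
Proof.
by case=> [[a b]|] //; rewrite -[b in LHS]cats0 polycyclic_mulR cats0.
Qed.

HB.instance Definition _ := isMonoid.Build (polycyclic L)
  polycyclic_mulA polycyclic_mul1x polycyclic_mulx1.

Definition polycyclic_zero : polycyclic L := None.
Definition polycyclic_gen (i : L) : polycyclic L := Some ([::], [:: i]).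
Definition polycyclic_geninv (i : L) : polycyclic L := Some ([:: i], [::]).

Lemma polycyclic_zeroP : is_zero polycyclic_zero.
Proof. by move=> x; split=> //; exact: polycyclic_mulx0. Qed.

Lemma polycyclic_genK i : polycyclic_gen i * polycyclic_geninv i = 1.
Proof. exact: (polycyclic_mulL [::] [:: i] [::] [::]). Qed.

Lemma polycyclic_genN i j :
  i != j -> polycyclic_gen i * polycyclic_geninv j = polycyclic_zero.
Proof.
move=> /negbTE nij; have nji : (j == i) = false by rewrite eq_sym.
by apply: polycyclic_mulN; rewrite suffixE /= eqseq_cons ?nij ?nji.
Qed.

End Polycyclic.

Section Presentation.
Variables (L : choiceType) (M : monoidType) (z : M) (p q : L -> M).

(* f maps the zero, the identity, p_i and p_i^-1 to z, 1, p i and q i. *)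
Definition polycyclic_hom (f : polycyclic L -> M) : Prop :=
  [/\ {morph f : x y / x * y}, f 1 = 1, f (polycyclic_zero L) = z,
      forall i, f (polycyclic_gen i) = p i
    & forall i, f (polycyclic_geninv i) = q i].

Fixpoint pword (a : seq L) : M := if a is i :: a' then p i * pword a' else 1.
Fixpoint qword (a : seq L) : M := if a is i :: a' then qword a' * q i else 1.
Definition polycyclic_lift (x : polycyclic L) : M :=
  if x is Some (a, b) then qword a * pword b else z.

Lemma pword_cat a b : pword (a ++ b) = pword a * pword b.
Proof. by elim: a => [|i a IH] /=; rewrite ?mul1g // IH mulgA. Qed.

Lemma qword_cat a b : qword (a ++ b) = qword b * qword a.
Proof. by elim: a => [|i a IH] /=; rewrite ?mulg1 // IH mulgA. Qed.

Lemma polycyclic_hom_uniq f : polycyclic_hom f -> f =1 polycyclic_lift.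
Proof.
case=> fM f1 f0 fp fq [[a b]|//].
have fb : f (Some ([::], b)) = pword b.
  elim: b => [|i b IH] /=; first exact: f1.
  by rewrite -fp -IH -fM [_ * _](polycyclic_mulR [::] [::] b [:: i]).
have fa : f (Some (a, [::])) = qword a.
  elim: a => [|i a IH] /=; first exact: f1.
  by rewrite -fq -IH -fM [_ * _](polycyclic_mulL a [::] [::] [:: i]).
by rewrite /= -fa -fb -fM [_ * _](polycyclic_mulL a [::] b [::]).
Qed.

Hypothesis z0 : is_zero z.
Hypothesis pqK : forall i, p i * q i = 1.
Hypothesis pqN : forall i j, i != j -> p i * q j = z.

Lemma pqword a : pword a * qword a = 1.
Proof.
elim: a => [|i a IH] /=; first by rewrite mulg1.
by rewrite mulgA -[_ * qword a]mulgA IH mulg1 pqK.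
Qed.

Lemma pqwordN a b : ~~ suffix a b -> ~~ suffix b a -> pword a * qword b = z.
Proof.
elim/last_ind: a b => [|a i IH] b; first by rewrite suffix0s.
case/lastP: b => [|b j]; first by rewrite suffix0s.
rewrite !suffix_rcons -!cats1 pword_cat qword_cat /= !mulg1 !mul1g.
rewrite mulgA -[_ * q j]mulgA [j == i]eq_sym.
have [->|/pqN ->] := eqVneq i j; last by rewrite (z0 _).2 (z0 _).1.
by rewrite pqK mulg1; exact: IH.
Qed.

Lemma polycyclic_lift_hom : polycyclic_hom polycyclic_lift.
Proof.
split=> [||//|i|i]; rewrite /= ?mulg1 ?mul1g //.
move=> [[a b]|] [[c d]|] /=; rewrite ?(z0 _).1 ?(z0 _).2 //.
have [u ->|v ->|Nbc Ncb] := word_cmpP b c.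
- rewrite [_ * _](polycyclic_mulL a b d u) /= !qword_cat.
  by rewrite -!mulgA [pword b * _]mulgA pqword mul1g.
- rewrite [_ * _](polycyclic_mulR a c d v) /= !pword_cat.
  by rewrite -!mulgA [pword c * _]mulgA pqword mul1g.
rewrite [_ * _](polycyclic_mulN a d Nbc Ncb) /=.
rewrite mulgA -[_ * pword b * _]mulgA (pqwordN Nbc Ncb).
by rewrite (z0 _).2 (z0 _).1.
Qed.

End Presentation.

(* [polycyclic L] is the monoid with zero presented by the generators p_i and
   p_i^-1 and the relations p_i p_i^-1 = 1, p_i p_j^-1 = 0 for i <> j. *)
Theorem polycyclic_presented (L : choiceType) (M : monoidType) (z : M)
    (p q : L -> M) :
  is_zero z -> (forall i, p i * q i = 1) ->
  (forall i j, i != j -> p i * q j = z) ->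
  exists f, polycyclic_hom z p q f /\
    forall g, polycyclic_hom z p q g -> g =1 f.
Proof.
move=> z0 pqK pqN; exists (polycyclic_lift z p q); split.
  exact: polycyclic_lift_hom.
exact: polycyclic_hom_uniq.
Qed.

(* Main.v *)
Require Import Defs.
From HB Require Import structures.
From mathcomp Require Import all_boot classical_sets.
Import Algebra.

Local Open Scope group_scope.

(** Any nonzero element can be turned into any other by multiplying on both sides
    ([bruck_reilly_factor]), because the values of [theta] are units. So an ideal with a nonzero
    element is the whole semigroup. *)

Lemma bruck_reilly_zeroP (L : choiceType) (S : monoidType)
    (theta : {multiplicative S -> S}) : is_zero (None : bruck_reilly L theta).
Proof. by move=> x; split=> //; exact: bruck_reilly_mulx0. Qed.

(* Multiplying by a word one letter longer than needed applies theta once to s,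
   so that the S-component becomes invertible and can then be cancelled. *)
Lemma bruck_reilly_factor (L : choiceType) (S : monoidType)
    (theta : {multiplicative S -> S}) (i : L) (s t : S) (a b c d : seq L) :
  group_of_units S (theta s) ->
  exists x y : bruck_reilly L theta,
    x * (Some (s, (a, b)) : bruck_reilly L theta) * y = Some (t, (c, d)).
Proof.
case=> r [sr _].
(* The first product is [(theta s, (c, i :: b))]; the second factor cancels [i :: b] and, through
   [r], also [theta s]. *)
exists (Some (1, (c, [:: i] ++ a))), (Some (r * t, ([::] ++ ([:: i] ++ b), d))).
rewrite [X in X * _](bruck_reilly_mulR theta 1 s c a b [:: i]).
rewrite [LHS]bruck_reilly_mulL /=.
by rewrite mul1g mulgA sr mul1g.
Qed.

Theorem mainTheorem4 (L : choiceType) (S : monoidType)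
    (theta : {multiplicative S -> S}) :
  inhabited L ->
  (forall s : S, group_of_units S (theta s)) ->
  zero_simple (bruck_reilly L theta).
Proof.
move=> [i] thetaU; have z0 := bruck_reilly_zeroP L S theta.
exists None; split=> // I [[w Iw] idI] InT.
have I0 : I None by have [] := idI None w Iw; rewrite (z0 w).1.
apply/seteqP; split=> [[[s [a b]]|] // Is|_ -> //].
(* A nonzero element in [I] would make [I] everything, against [InT]. *)
case: InT; apply/seteqP; split=> // -[[t [c d]]|] // _.
have [x [y <-]] := bruck_reilly_factor L S theta i s t a b c d (thetaU s).
exact: (idI y _ (idI x _ Is).1).2.
Qed.
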